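(* Let $\mathcal{E}$ be the Dirichlet form of a generator $L$ on a finite probability space $(\Omega,\mu)$. Let $I$ be a non-empty convex subset of $\mathbb{R}$. Assume that functions $\varphi_1,\varphi_2,\psi_1,\psi_2:I\to\mathbb{R}$ satisfy $$(\varphi_1(a)-\varphi_1(b))(\varphi_2(a)-\varphi_2(b))\le(\psi_1(a)-\psi_1(b))(\psi_2(a)-\psi_2(b))$$ for all $a,b\in I$. Then for every $f:\Omega\to I$ $$\mathcal{E}(\varphi_1(f),\varphi_2(f))\le\mathcal{E}(\psi_1(f),\psi_2(f)),$$ where $\varphi_1(f)$ denotes $\varphi_1\circ f$, etc.
   Context: Setting: $(\Omega,\mu)$ is a finite probability space with $\mu\{\omega\}>0$ for all $\omega\in\Omega$; $\mathbb{E}f=\int_\Omega f\,d\mu$; $\mathcal{H}$ is the space of real-valued functions on $\Omega$. A generator is a linear operator $L:\mathcal{H}\to\mathcal{H}$ such that: $L1=0$; $\mathbb{E}[fLg]=\mathbb{E}[gLf]$ for all $f,g\in\mathcal{H}$; $\mathbb{E}[fLf]\ge 0$ for all $f\in\mathcal{H}$; and whenever $f\in\mathcal{H}$ and $\omega\in\Omega$ satisfy $f\le f(\omega)$ on $\Omega$, then $(Lf)(\omega)\ge 0$. The Dirichlet form is $\mathcal{E}(f,g)=\mathbb{E}[fLg]$. *)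

(* Defs.v *)
From HB Require Import structures.
From mathcomp Require Import all_boot all_order all_algebra.
From mathcomp Require Import all_classical all_reals all_analysis.

Set Implicit Arguments.
Unset Strict Implicit.
Unset Printing Implicit Defensive.

Import Order.TTheory GRing.Theory Num.Theory.
Import numFieldNormedType.Exports.

Local Open Scope classical_set_scope.
Local Open Scope ring_scope.

(* The sigma-algebra of a finite probability space is its full power set. *)
Record finite_probability_space (R : realType) (d : measure_display)
    (Omega : measurableType d) (mu : probability Omega R) : Prop := {
  fps_finite : finite_set [set: Omega];
  fps_measurable : forall A : set Omega, measurable A;
  fps_gt0 : forall w : Omega, (0 < mu [set w])%E }.

(* [\int] is the real-valued Lebesgue integral [Rintegral]. It equals 0 by
   convention when the integral is infinite or undefined, which cannot happen
   on a finite probability space. *)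
Definition expect (R : realType) (d : measure_display)
    (Omega : measurableType d) (mu : probability Omega R) (f : Omega -> R) : R :=
  \int[mu]_(w in [set: Omega]) f w.

(* [R^o] is [R] seen as a vector space over itself, so that [Omega -> R^o] is
   the real vector space of real-valued functions on [Omega]. *)
Record is_generator (R : realType) (d : measure_display)
    (Omega : measurableType d) (mu : probability Omega R)
    (L : {linear (Omega -> R^o) -> (Omega -> R^o)}) : Prop := {
  gen_cst1 : L (cst 1) = cst 0;
  gen_sym : forall f g : Omega -> R^o,
    expect mu (fun w => f w * L g w) = expect mu (fun w => g w * L f w);
  gen_ge0 : forall f : Omega -> R^o, 0 <= expect mu (fun w => f w * L f w);
  gen_max : forall (f : Omega -> R^o) (w : Omega),
    (forall w' : Omega, f w' <= f w) -> 0 <= L f w }.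

Definition dirichlet_form (R : realType) (d : measure_display)
    (Omega : measurableType d) (mu : probability Omega R)
    (L : {linear (Omega -> R^o) -> (Omega -> R^o)}) (f g : Omega -> R^o) : R :=
  expect mu (fun w => f w * L g w).

(* Main.v *)
Require Import Defs.
From HB Require Import structures.
From mathcomp Require Import all_boot all_order all_algebra.
From mathcomp Require Import all_classical all_reals all_analysis.
From mathcomp Require Import ring.

Import Order.TTheory GRing.Theory Num.Theory.
Import numFieldNormedType.Exports.

Local Open Scope classical_set_scope.
Local Open Scope ring_scope.

(** The operator [L] behaves like minus a Laplacian, and its form has a pointwise
    density, the carre du champ.  For functions [u], [v] and a point [x], let
    [g_x = (u - u x) (v - v x)].  Expanding the product and using [L 1 = 0],

      [- L g_x x = u x * L v x + v x * L u x - L (u v) x].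

    In expectation the last term vanishes, since by symmetry
    [E[1 * L (u v)] = E[u v * L 1] = 0], and the first two both equal the
    Dirichlet form; hence [2 E(u, v)] is the expectation of [x |-> - L g_x x]
    ([dirichlet_formE]).

    Now take [u, v = phi1 \o f, phi2 \o f] and compare with
    [h_x = (p - p x) (q - q x)] for [p, q = psi1 \o f, psi2 \o f].  The hypothesis
    says that [g_x <= h_x] everywhere, while both vanish at [x]: so [g_x - h_x] is
    maximal at [x], and the maximum principle gives [L h_x x <= L g_x x]
    ([generator_le_at_contact]).  Integrating over [x] concludes. *)

Section FiniteExpectation.
Context (R : realType) (d : measure_display) (Omega : measurableType d).
Context (mu : probability Omega R).
Context (fps : finite_probability_space mu).

Lemma integrable_finite_space (f : Omega -> R) :
  mu.-integrable [set: Omega] (EFin \o f).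
Proof.
case: fps => fin meas _.
apply: measurable_bounded_integrable => [||_ B _|] //.
- by rewrite ltey_eq fin_num_measure.
- have [M [Mreal fM]] := compact_bounded (finite_compact (finite_image f fin)).
  by exists M; split=> // r /fM fr w _; apply: fr; exists w.
Qed.

Lemma expectD (f g : Omega -> R) :
  expect mu (fun w => f w + g w) = expect mu f + expect mu g.
Proof. by rewrite /expect RintegralD //; exact: integrable_finite_space. Qed.

Lemma expectB (f g : Omega -> R) :
  expect mu (fun w => f w - g w) = expect mu f - expect mu g.
Proof. by rewrite /expect RintegralB //; exact: integrable_finite_space. Qed.

Lemma le_expect (f g : Omega -> R) :
  (forall w, f w <= g w) -> expect mu f <= expect mu g.
Proof.
by move=> fg; apply: le_Rintegral => //; exact: integrable_finite_space.
Qed.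

End FiniteExpectation.

Section Generator.
Context (R : realType) (d : measure_display) (Omega : measurableType d).
Context (mu : probability Omega R).
Context (L : {linear (Omega -> R^o) -> (Omega -> R^o)}).
Context (genL : is_generator mu L).

Definition centered_mul (u v : Omega -> R^o) (x : Omega) : Omega -> R^o :=
  fun w => (u w - u x) * (v w - v x).

Lemma generator_centered_mul (u v : Omega -> R^o) (x : Omega) :
  - L (centered_mul u v x) x = u x * L v x + v x * L u x - L (u \* v) x.
Proof.
have -> : centered_mul u v x =
    (u \* v) - u x *: v - v x *: u + (u x * v x) *: cst 1.
  apply/funext => w; rewrite /centered_mul !fctE /GRing.scale /=.
  ring.
rewrite linearD !linearB !linearZ /= (gen_cst1 genL) !fctE /GRing.scale /=.
ring.
Qed.

(** Invariance of [mu]: symmetry moves [L] onto the constant 1, which it kills. *)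
Lemma expect_generator (f : Omega -> R^o) : expect mu (L f) = 0.
Proof.
have := gen_sym genL (cst 1) f; rewrite (gen_cst1 genL).
under eq_fun do rewrite mul1r.
under [in X in _ = X -> _]eq_fun do rewrite mulr0.
by move=> ->; rewrite /expect /Rintegral integral0.
Qed.

(** [g - h] attains its maximum at the contact point [x], so the maximum
    principle applies to it there. *)
Lemma generator_le_at_contact (g h : Omega -> R^o) (x : Omega) :
  (forall w, g w <= h w) -> g x = h x -> L h x <= L g x.
Proof.
move=> gh ghx; rewrite -subr_ge0.
have -> : L g x - L h x = L (g - h) x by rewrite linearB.
apply: (gen_max genL) => w.
by rewrite !fctE ghx subrr subr_le0.
Qed.

(** The carre du champ formula: the right-hand side depends on [u] and [v] only
    through products of increments, which is what the hypothesis of the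
    comparison theorem controls. *)
Lemma dirichlet_formE (u v : Omega -> R^o) : finite_probability_space mu ->
  dirichlet_form mu L u v *+ 2 = expect mu (fun x => - L (centered_mul u v x) x).
Proof.
move=> fps; under eq_fun do rewrite generator_centered_mul.
rewrite expectB // expectD // expect_generator subr0.
by rewrite (gen_sym genL v u) -mulr2n.
Qed.

End Generator.

Theorem lemma2p3 (R : realType) (d : measure_display)
    (Omega : measurableType d) (mu : probability Omega R)
    (L : {linear (Omega -> R^o) -> (Omega -> R^o)})
    (I : set (convex_lmodType R^o)) (phi1 phi2 psi1 psi2 : I -> R) :
  finite_probability_space mu ->
  is_generator mu L ->
  I !=set0 ->
  convex_set I ->
  (forall a b : I,
    (phi1 a - phi1 b) * (phi2 a - phi2 b)
      <= (psi1 a - psi1 b) * (psi2 a - psi2 b)) ->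
  forall f : Omega -> I,
    dirichlet_form mu L (phi1 \o f) (phi2 \o f)
      <= dirichlet_form mu L (psi1 \o f) (psi2 \o f).
Proof.
move=> fps genL _ _ phi_psi f.
rewrite -(ler_pMn2r (n := 2)) // !dirichlet_formE //.
apply: le_expect => // x; rewrite lerN2.
apply: (generator_le_at_contact _ _ _ _ _ genL) => [w|].
  exact: phi_psi.
by rewrite /centered_mul !subrr !mul0r.
Qed.
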